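(* The canonical triple $S^G$ over a finite weighted undirected graph $G$ (as defined in the context) is of WAL type.
   Context: **Canonical triple.** $G=(V,E,\delta)$ is a finite simple undirected graph (not necessarily connected) with weights $\delta_e>0$, $e\in E$. Choose an arbitrary orientation of each edge, with source $e^-$ and target $e^+$, and arbitrary phases $\theta_e\in\mathbb{R}$. $\mathcal A$ is the $C^*$-algebra of complex functions on $V$; $H=\mathbb{C}^E\otimes\mathbb{C}^2=\bigoplus_{e\in E}\mathbb{C}^2$ with canonical scalar product, each summand having basis $(-,+)$; $$\pi(a)=\bigoplus_e\begin{pmatrix}a(e^-)&0\\ 0&a(e^+)\end{pmatrix},\quad D=\bigoplus_e\frac1{\delta_e}\begin{pmatrix}0&e^{i\theta_e}\\ e^{-i\theta_e}&0\end{pmatrix},$$ $$\chi=\bigoplus_e\begin{pmatrix}-1&0\\ 0&1\end{pmatrix},\quad J=\bigoplus_e\begin{pmatrix}e^{i\theta_e}&0\\ 0&e^{-i\theta_e}\end{pmatrix}\circ\text{(complex conjugation)}.$$ Then $S^G=(\mathcal A,H,\pi,D,J,\chi)$, a real even spectral triple of KO-dimension 0. **WAL type.** For an operator $D$, $\Omega^1_D(\mathcal A,\pi)=\{\sum_i\pi(a_i)[D,\pi(b_i)]\ (\text{finite sums}),\ a_i,b_i\in\mathcal A\}$. A real even spectral triple $(\mathcal A,H,\pi,D,J,\chi)$ is of *WAL type* (''Wick-anti-Lorentz'') if there exists $\omega\in\Omega^1_D(\mathcal A,\pi)$ with $\omega=\omega^*$ such that $$J\omega J^{-1}=-\omega,\quad\omega^2=1,\quad\omega\in\Omega^1_{D_\omega}(\mathcal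 A,\pi),\quad\text{where }D_\omega=\frac{1-i}2D+\frac{1+i}2\omega D\omega^{-1}.$$ *)

(* Defs.v *)
From HB Require Import structures.
From mathcomp Require Import all_boot all_order all_algebra.
From mathcomp Require Import reals trigo.
From mathcomp Require Import complex.

Set Implicit Arguments.
Unset Strict Implicit.
Unset Printing Implicit Defensive.

Import Order.TTheory GRing.Theory Num.Theory.
Local Open Scope ring_scope.

(* Unital *-algebras over the complex numbers R[i], the scalars being given by
   their (central) image in the ring.  The algebra structures of MathComp
   exclude the zero ring, which is the algebra of functions on the empty set. *)
Record star_algebra (R : realType) := StarAlgebra {
  star_ring :> pzRingType;
  scal : {rmorphism R[i] -> star_ring};
  scal_central : forall k a, scal k * a = a * scal k;
  star : {additive star_ring -> star_ring};
  starK : involutive star;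
  starM : forall a b, star (a * b) = star b * star a;
  star_scal : forall k, star (scal k) = scal (Num.conj k)
}.

Section FunctionAlgebra.
Variables (R : realType) (V : finType).
Local Notation A := {ffun V -> R[i]}.

Definition ffun_scal (k : R[i]) : A := [ffun=> k].

Definition ffun_star (a : A) : A := [ffun v => Num.conj (a v)].

Fact ffun_scal_additive : additive ffun_scal.
Proof. by move=> k l; apply/ffunP=> v; rewrite !ffunE. Qed.
Fact ffun_scal_multiplicative : multiplicative ffun_scal.
Proof. by split=> [k l|]; apply/ffunP=> v; rewrite !ffunE. Qed.
HB.instance Definition _ :=
  GRing.isAdditive.Build R[i] A ffun_scal ffun_scal_additive.
HB.instance Definition _ :=
  GRing.isMultiplicative.Build R[i] A ffun_scal ffun_scal_multiplicative.

Fact ffun_star_additive : additive ffun_star.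
Proof. by move=> a b; apply/ffunP=> v; rewrite !ffunE rmorphB. Qed.
HB.instance Definition _ :=
  GRing.isAdditive.Build A A ffun_star ffun_star_additive.

Fact ffun_scal_central (k : R[i]) (a : A) : ffun_scal k * a = a * ffun_scal k.
Proof. by apply/ffunP=> v; rewrite !ffunE mulrC. Qed.
Fact ffun_starK : involutive ffun_star.
Proof. by move=> a; apply/ffunP=> v; rewrite !ffunE conjCK. Qed.
Fact ffun_starM (a b : A) : ffun_star (a * b) = ffun_star b * ffun_star a.
Proof. by apply/ffunP=> v; rewrite !ffunE rmorphM mulrC. Qed.
Fact ffun_star_scal (k : R[i]) :
  ffun_star (ffun_scal k) = ffun_scal (Num.conj k).
Proof. by apply/ffunP=> v; rewrite !ffunE. Qed.

Definition ffun_alg : star_algebra R :=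
  @StarAlgebra R A ffun_scal ffun_scal_central ffun_star ffun_starK ffun_starM
    ffun_star_scal.

End FunctionAlgebra.

Definition is_adjoint (C : numClosedFieldType) (H : vectType C)
    (dot : {dot H for Num.conj}) (f g : 'End(H)) : Prop :=
  forall u v : H, dot (f u) v = dot u (g v).

(* Finite-dimensional real even spectral triples.  [eps] and [eps''] encode the
   KO-signs J^2 = (-1)^eps and J chi = (-1)^eps'' chi J; in even KO-dimension
   the third sign is always J D = D J.  The first-order condition is not
   imposed: it fails for canonical triples of graphs, where J pi(b) J^-1 is
   the conjugate of pi(b). *)
Record real_even_triple (R : realType) := RealEvenTriple {
  alg : star_algebra R;
  hilb : vectType R[i];
  hdot : {dot hilb for Num.conj};
  rep : {additive alg -> 'End(hilb)};
  rep_scal : forall k, rep (scal alg k) = k *: \1%VF;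
  repM : forall a b, rep (a * b) = (rep a \o rep b)%VF;
  rep_star : forall a, is_adjoint hdot (rep a) (rep (star alg a));
  dirac : 'End(hilb);
  dirac_sa : is_adjoint hdot dirac dirac;
  real_str : {linear hilb -> hilb | Num.conj \; *:%R};
  real_inv : hilb -> hilb;
  real_strK : cancel real_str real_inv;
  real_invK : cancel real_inv real_str;
  real_str_anti : forall u v, hdot (real_str u) (real_str v) = hdot v u;
  chir : 'End(hilb);
  chir_sa : is_adjoint hdot chir chir;
  chir2 : (chir \o chir)%VF = \1%VF;
  chir_rep : forall a, (chir \o rep a)%VF = (rep a \o chir)%VF;
  chir_dirac : (chir \o dirac)%VF = - (dirac \o chir)%VF;
  eps : bool;
  eps'' : bool;
  real_str2 : forall u, real_str (real_str u) = (-1) ^+ eps *: u;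
  real_str_dirac : forall u, real_str (dirac u) = dirac (real_str u);
  real_str_chir : forall u,
    real_str (chir u) = (-1) ^+ eps'' *: chir (real_str u);
  order_zero : forall a b u,
    rep a (real_str (rep b (real_inv u))) =
    real_str (rep b (real_inv (rep a u)))
}.

Arguments real_inv {R} r _ : assert.

Definition KO_dim (R : realType) (T : real_even_triple R) : nat :=
  match eps T, eps'' T with
  | false, false => 0
  | true,  true  => 2
  | true,  false => 4
  | false, true  => 6
  end.

Definition Omega1 (R : realType) (T : real_even_triple R)
    (D omega : 'End(hilb T)) : Prop :=
  exists (n : nat) (a b : 'I_n -> alg T),
    omega = \sum_(i < n)
      (rep T (a i) \o ((D \o rep T (b i)) - (rep T (b i) \o D)))%VF.

Definition wick_dirac (R : realType) (T : real_even_triple R)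
    (omega : 'End(hilb T)) : 'End(hilb T) :=
  ((1 - 'i) / 2) *: dirac T
  + ((1 + 'i) / 2) *: (omega \o dirac T \o omega^-1)%VF.

Definition WAL_type (R : realType) (T : real_even_triple R) : Prop :=
  exists omega : 'End(hilb T),
    Omega1 (dirac T) omega /\
    is_adjoint (hdot T) omega omega /\
    (forall u, real_str T (omega (real_inv T u)) = - omega u) /\
    (omega \o omega)%VF = \1%VF /\
    Omega1 (wick_dirac omega) omega.

(* Simple graphs have 2-element sets of vertices as edges; vertices may be
   isolated, and the vertex set may be empty. *)
Record wgraph (R : realType) := WGraph {
  vertex : finType;
  edges : {set {set vertex}};
  edges_card : forall e, e \in edges -> #|e| = 2%N;
  weight : {e | e \in edges} -> R;
  weight_gt0 : forall e, 0 < weight e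
}.

Definition edge (R : realType) (G : wgraph R) : finType :=
  {e : {set vertex G} | e \in edges G}.

Record orientation (R : realType) (G : wgraph R) := Orientation {
  src : edge G -> vertex G;
  tgt : edge G -> vertex G;
  orientP : forall e, val e = [set src e; tgt e]
}.

Definition mx2 (C : nmodType) (a b c d : C) : 'M[C]_2 :=
  \matrix_(i, j) if i == 0 then (if j == 0 then a else b)
                           else (if j == 0 then c else d).

Definition expi (R : realType) (t : R) : R[i] := (cos t +i* sin t)%C.

Section BlockOperators.
Variables (C : numClosedFieldType) (E : finType).

(* Orthogonal direct sum of copies of C^2 indexed by E; in each summand the
   index 0 stands for the basis vector "-" and 1 for "+". *)
Definition ell2 : vectType C := {ffun E -> 'cV[C]_2}.
Implicit Types (u v : ell2) (M N : E -> 'M[C]_2).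

Definition ell2_dot u v : C :=
  \sum_e \sum_(s < 2) u e s 0 * Num.conj (v e s 0).

Definition block_fun M u : ell2 := [ffun e => M e *m u e].

Definition block_conj M u : ell2 := [ffun e => M e *m map_mx Num.conj (u e)].

Fact block_fun_linear M : linear (block_fun M).
Proof.
by move=> k u v; apply/ffunP=> e; rewrite !ffunE mulmxDr -scalemxAr.
Qed.
HB.instance Definition _ M :=
  GRing.isLinear.Build C ell2 ell2 *:%R (block_fun M) (block_fun_linear M).

Definition block_op M : 'End(ell2) := linfun (block_fun M).

Fact block_conj_linear M : linear_for (Num.conj \; *:%R) (block_conj M).
Proof.
move=> k u v; apply/ffunP=> e; rewrite !ffunE map_mxD map_mxZ mulmxDr.
by rewrite -scalemxAr.
Qed.
HB.instance Definition _ M :=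
  GRing.isLinear.Build C ell2 ell2 (Num.conj \; *:%R) (block_conj M)
    (block_conj_linear M).

Lemma block_opE M u e : block_op M u e = M e *m u e.
Proof. by rewrite lfunE /= ffunE. Qed.

Lemma block_opM M N :
  (block_op M \o block_op N)%VF = block_op (fun e => M e *m N e).
Proof.
by apply/lfunP=> u; apply/ffunP=> e; rewrite comp_lfunE !block_opE mulmxA.
Qed.

Lemma eq_block_op M N : M =1 N -> block_op M = block_op N.
Proof.
by move=> eqMN; apply/lfunP=> u; apply/ffunP=> e; rewrite !block_opE eqMN.
Qed.

Lemma block_op1 : block_op (fun=> 1%:M) = \1%VF.
Proof.
by apply/lfunP=> u; apply/ffunP=> e; rewrite block_opE mul1mx id_lfunE.
Qed.

Lemma block_opN M : - block_op M = block_op (fun e => - M e).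
Proof.
apply/lfunP=> u; apply/ffunP=> e.
by rewrite opp_lfunE ffunE !block_opE mulNmx.
Qed.

Fact ell2_dot_linearl v : linear_for *%R (ell2_dot^~ v).
Proof.
move=> k u u' /=; rewrite /ell2_dot mulr_sumr -big_split /=.
apply: eq_bigr => e _; rewrite mulr_sumr -big_split /=.
by apply: eq_bigr => s _; rewrite !ffunE !mxE mulrDl mulrA.
Qed.

Fact ell2_dot_linearr u : linear_for (Num.conj \; *%R) (ell2_dot u).
Proof.
move=> k v v' /=; rewrite /ell2_dot mulr_sumr -big_split /=.
apply: eq_bigr => e _; rewrite mulr_sumr -big_split /=.
by apply: eq_bigr => s _; rewrite !ffunE !mxE rmorphD rmorphM mulrDr mulrCA.
Qed.

HB.instance Definition _ :=
  bilinear_isBilinear.Build C ell2 ell2 C *%R (Num.conj \; *%R) ell2_dot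
    (ell2_dot_linearl, ell2_dot_linearr).

Fact ell2_dotC u v : ell2_dot u v = (-1) ^+ false * Num.conj (ell2_dot v u).
Proof.
rewrite expr0 mul1r rmorph_sum; apply: eq_bigr => e _.
by rewrite rmorph_sum; apply: eq_bigr => s _; rewrite rmorphM /= conjCK mulrC.
Qed.
HB.instance Definition _ :=
  isHermitianSesquilinear.Build C ell2 false Num.conj ell2_dot ell2_dotC.

Fact ell2_dot_gt0 u : u != 0 -> 0 < ell2_dot u u.
Proof.
move=> u_neq0; have ge0 e : 0 <= \sum_(s < 2) u e s 0 * Num.conj (u e s 0).
  by apply: sumr_ge0 => s _; rewrite mul_conjC_ge0.
rewrite lt_def sumr_ge0 ?andbT //; apply: contraNneq u_neq0 => /eqP.
rewrite psumr_eq0 // => /allP u0; apply/eqP/ffunP=> e; apply/colP=> s.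
have /u0/= := mem_index_enum e.
rewrite psumr_eq0 => [/allP/(_ s (mem_index_enum s))|t _].
  by rewrite mul_conjC_eq0 ffunE mxE => /eqP.
by rewrite mul_conjC_ge0.
Qed.
HB.instance Definition _ :=
  isDotProduct.Build C ell2 ell2_dot ell2_dot_gt0.

End BlockOperators.

Section Mx2.
Variable C : numClosedFieldType.
Implicit Types a b c d : C.

Lemma mx2M a b c d a' b' c' d' :
  mx2 a b c d *m mx2 a' b' c' d' =
  mx2 (a * a' + b * c') (a * b' + b * d') (c * a' + d * c') (c * b' + d * d').
Proof.
apply/matrixP=> i j; rewrite !mxE !big_ord_recl big_ord0 addr0 !mxE /=.
by case: (i == 0); case: (j == 0).
Qed.

Lemma mx2Z k a b c d : k *: mx2 a b c d = mx2 (k * a) (k * b) (k * c) (k * d).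
Proof. by apply/matrixP=> i j; rewrite !mxE; do 2!case: ifP. Qed.

Lemma mx2N a b c d : - mx2 a b c d = mx2 (- a) (- b) (- c) (- d).
Proof. by apply/matrixP=> i j; rewrite !mxE; do 2!case: ifP. Qed.

Lemma mx2_map a b c d :
  map_mx Num.conj (mx2 a b c d) =
  mx2 (Num.conj a) (Num.conj b) (Num.conj c) (Num.conj d).
Proof. by apply/matrixP=> i j; rewrite !mxE; do 2!case: ifP. Qed.

Lemma mx2_tr a b c d : (mx2 a b c d)^T = mx2 a c b d.
Proof. by apply/matrixP=> i j; rewrite !mxE; do 2!case: ifP. Qed.

Lemma mx2_scalar a : mx2 a 0 0 a = a%:M.
Proof.
apply/matrixP=> i j; rewrite !mxE.
by case: i => [[|[|//]] ?]; case: j => [[|[|//]] ?].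
Qed.

End Mx2.

Section BlockAdjoint.
Variables (C : numClosedFieldType) (E : finType).
Implicit Types M N : E -> 'M[C]_2.

Lemma block_adjoint M N :
  (forall e, map_mx Num.conj (M e)^T = N e) ->
  is_adjoint (@ell2_dot C E) (block_op M) (block_op N).
Proof.
move=> MN u v; apply: eq_bigr => e _; rewrite !block_opE -MN.
under eq_bigr do rewrite mxE mulr_suml.
rewrite exchange_big /=; apply: eq_bigr => s _.
rewrite mxE rmorph_sum mulr_sumr; apply: eq_bigr => t _.
by rewrite !mxE rmorphM /= conjCK mulrCA mulrA.
Qed.

Lemma block_conjM M N u :
  block_conj M (block_conj N u) =
  block_op (fun e => M e *m map_mx Num.conj (N e)) u.
Proof.
apply/ffunP=> e; rewrite block_opE !ffunE map_mxM mulmxA.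
by congr (_ *m _); apply/matrixP=> i j; rewrite !mxE /= conjCK.
Qed.

Lemma block_conj_op M N u :
  block_conj M (block_op N u) =
  block_conj (fun e => M e *m map_mx Num.conj (N e)) u.
Proof. by apply/ffunP=> e; rewrite !ffunE block_opE map_mxM mulmxA. Qed.

Lemma block_op_conj M N u :
  block_op M (block_conj N u) = block_conj (fun e => M e *m N e) u.
Proof. by apply/ffunP=> e; rewrite block_opE !ffunE mulmxA. Qed.

Lemma block_conj_anti M :
  (forall e, map_mx Num.conj (M e)^T *m M e = 1%:M) ->
  forall u v : ell2 C E,
    ell2_dot (block_conj M u) (block_conj M v) = ell2_dot v u.
Proof.
have dotE (u v : ell2 C E) :
    ell2_dot u v = \sum_e (map_mx Num.conj (v e)^T *m u e) 0 0.
  apply: eq_bigr => e _; rewrite mxE; apply: eq_bigr => s _.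
  by rewrite !mxE mulrC.
move=> M1 u v; rewrite !dotE; apply: eq_bigr => e _.
rewrite !ffunE trmx_mul map_mxM mulmxA -[_ *m _ *m M e]mulmxA M1 mulmx1.
rewrite mxE [RHS]mxE; apply: eq_bigr => s _.
by rewrite !mxE /= conjCK mulrC.
Qed.

End BlockAdjoint.

Section Canonical.
Variables (R : realType) (G : wgraph R) (o : orientation G).
Variable theta : edge G -> R.
Local Notation A := (ffun_alg R (vertex G)).
Local Notation H := (ell2 R[i] (edge G)).

Definition canon_rep (a : A) : 'End(H) :=
  block_op (fun e => mx2 (a (src o e)) 0 0 (a (tgt o e))).

Definition canon_dirac : 'End(H) :=
  block_op (fun e => ((weight e)^-1)%:C%C *:
                     mx2 0 (expi (theta e)) (expi (- theta e)) 0).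

Definition canon_chir : 'End(H) := block_op (fun=> mx2 (-1) 0 0 1).

Definition canon_real : H -> H :=
  block_conj (fun e => mx2 (expi (theta e)) 0 0 (expi (- theta e))).
HB.instance Definition _ := GRing.Linear.on canon_real.

Lemma realC_conj (x : R) : Num.conj x%:C%C = x%:C%C.
Proof. exact: conjc_real. Qed.

Lemma expi_conj (t : R) : Num.conj (expi t) = expi (- t).
Proof. by rewrite /expi cosN sinN. Qed.

Lemma expiNr (t : R) : expi t * expi (- t) = 1.
Proof.
rewrite /expi cosN sinN; apply/eqP; rewrite eq_complex /= mulrN opprK -!expr2.
by rewrite cos2Dsin2 eqxx /= mulrN mulrC addNr.
Qed.

Lemma expiNl (t : R) : expi (- t) * expi t = 1.
Proof. by rewrite mulrC expiNr. Qed.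

Local Notation C := R[i].
Let simp := (@mx2M C, @mx2Z C, @mx2N C, @mx2_map C, @mx2_tr C, expi_conj,
  @opprK R, @opprK C, @conjC0 C, @conjC1 C, @mulr0 C, @mul0r C, @addr0 C,
  @add0r C, expiNr, expiNl, @mulr1 C, @mul1r C, @oppr0 C, @rmorphN1 C C,
  @mulrN1 C, @mulN1r C).

Fact canon_rep_additive : additive canon_rep.
Proof.
move=> a b; apply/lfunP=> u; apply/ffunP=> e.
rewrite add_lfunE opp_lfunE !ffunE !block_opE -mulmxBl; congr (_ *m _).
by apply/matrixP=> i j; rewrite !mxE !ffunE; do 2!case: ifP; rewrite ?subr0.
Qed.
HB.instance Definition _ :=
  GRing.isAdditive.Build A 'End(H) canon_rep canon_rep_additive.

Fact canon_rep_scal k : canon_rep (scal A k) = k *: \1%VF.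
Proof.
apply/lfunP=> u; apply/ffunP=> e.
by rewrite block_opE !ffunE mx2_scalar scale_lfunE id_lfunE ffunE mul_scalar_mx.
Qed.

Fact canon_repM a b : canon_rep (a * b) = (canon_rep a \o canon_rep b)%VF.
Proof. by rewrite block_opM; apply: eq_block_op => e; rewrite !simp !ffunE. Qed.

Fact canon_rep_star a :
  is_adjoint (@ell2_dot _ _) (canon_rep a) (canon_rep (star A a)).
Proof. by apply: block_adjoint => e; rewrite !simp !ffunE. Qed.

Fact canon_dirac_sa : is_adjoint (@ell2_dot _ _) canon_dirac canon_dirac.
Proof.
by apply: block_adjoint => e; rewrite !simp !rmorphM /= !realC_conj !simp.
Qed.

Fact canon_realK u : canon_real (canon_real u) = u.
Proof.
rewrite /canon_real block_conjM -[RHS]id_lfunE -block_op1.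
congr (fun_of_lfun _ u).
by apply: eq_block_op => e; rewrite !simp mx2_scalar.
Qed.

Fact canon_real_anti u v :
  ell2_dot (canon_real u) (canon_real v) = ell2_dot v u.
Proof. by apply: block_conj_anti => e; rewrite !simp mx2_scalar. Qed.

Fact canon_chir_sa : is_adjoint (@ell2_dot _ _) canon_chir canon_chir.
Proof. by apply: block_adjoint => e; rewrite !simp. Qed.

Fact canon_chir2 : (canon_chir \o canon_chir)%VF = \1%VF.
Proof.
rewrite block_opM -block_op1; apply: eq_block_op => e.
by rewrite !simp mx2_scalar.
Qed.

Fact canon_chir_rep a :
  (canon_chir \o canon_rep a)%VF = (canon_rep a \o canon_chir)%VF.
Proof. by rewrite !block_opM; apply: eq_block_op => e; rewrite !simp. Qed.

Fact canon_chir_dirac :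
  (canon_chir \o canon_dirac)%VF = - (canon_dirac \o canon_chir)%VF.
Proof.
by rewrite !block_opM block_opN; apply: eq_block_op => e; rewrite !simp.
Qed.

Lemma eq_block_conj (M N : edge G -> 'M[R[i]]_2) u :
  M =1 N -> block_conj M u = block_conj N u.
Proof. by move=> eqMN; apply/ffunP=> e; rewrite !ffunE eqMN. Qed.

Fact canon_real2 u : canon_real (canon_real u) = (-1) ^+ false *: u.
Proof. by rewrite canon_realK scale1r. Qed.

Fact canon_real_dirac u :
  canon_real (canon_dirac u) = canon_dirac (canon_real u).
Proof.
rewrite /canon_real block_conj_op block_op_conj; apply: eq_block_conj => e.
rewrite !simp !rmorphM /= !realC_conj !simp -!mulrA.
by rewrite ![expi _ * (_ * _)]mulrCA !simp.
Qed.

Fact canon_real_chir u :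
  canon_real (canon_chir u) = (-1) ^+ false *: canon_chir (canon_real u).
Proof.
rewrite /canon_real scale1r block_conj_op block_op_conj.
apply: eq_block_conj => e.
by rewrite !simp.
Qed.

Lemma canon_real_rep b u :
  canon_real (canon_rep b (canon_real u)) = canon_rep (star A b) u.
Proof.
rewrite /canon_real block_conj_op block_conjM; congr (fun_of_lfun _ u).
apply: eq_block_op => e; rewrite !simp !ffunE.
by rewrite mulrAC expiNr mulrAC expiNl !simp.
Qed.

Fact canon_order_zero a b u :
  canon_rep a (canon_real (canon_rep b (canon_real u))) =
  canon_real (canon_rep b (canon_real (canon_rep a u))).
Proof.
by rewrite !canon_real_rep -!comp_lfunE -!canon_repM; congr (canon_rep _ u);
  apply/ffunP=> v; rewrite !ffunE mulrC.
Qed.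

Definition canonical_triple : real_even_triple R :=
  @RealEvenTriple R A H (@ell2_dot _ _) canon_rep canon_rep_scal canon_repM
    canon_rep_star canon_dirac canon_dirac_sa canon_real canon_real
    canon_realK canon_realK canon_real_anti canon_chir canon_chir_sa
    canon_chir2 canon_chir_rep canon_chir_dirac false false canon_real2
    canon_real_dirac canon_real_chir canon_order_zero.

Lemma canonical_KO_dim : KO_dim canonical_triple = 0%N.
Proof. by []. Qed.

End Canonical.

(* Main.v *)
Require Import Defs.
From mathcomp Require Import all_boot all_order all_algebra.
From mathcomp Require Import reals.
From mathcomp Require Import complex ring.

(** Write [d = expi (theta e) / weight e] for the upper right entry of [D] in
    the summand of the edge [e], so that its lower left entry is the conjugate
    of [d].  The form [omega] is the opposite of [i chi F], where [F] is the
    phase of [D]: on the edge [e] its off-diagonal entries are [i expi (theta e)]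
    and the conjugate of that number.  Hence [omega] is self-adjoint and squares
    to 1; the factor [i] makes it change sign under [J], and the factor [chi]
    makes it anticommute with [D].

    Anticommutation settles the condition on the Wick rotated operator: then
    [omega D omega^-1 = - D], so the rotated operator is [- i D], a nonzero
    multiple of [D], and has the same one-forms as [D] ([wick_diracE],
    [Omega1Z]).

    It remains that [omega] is a one-form for [D], and this is where the graph
    matters.  A function [c] of two vertices that vanishes on the diagonal
    represents the one-form whose entries on [e] are those of [D] multiplied by
    [c (e-) (e+)] and [c (e+) (e-)] ([Omega1_kernel]).  So what is needed is
    a [c] with [c (e-) (e+) = i weight e] and [c (e+) (e-) = - i weight e] for
    all [e] at once; it exists because an edge of a simple graph is determined by
    its two ends ([weight_kernel_edge]). *)

Set Implicit Arguments.
Unset Strict Implicit.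
Unset Printing Implicit Defensive.

Import Order.TTheory GRing.Theory Num.Theory.
Local Open Scope ring_scope.

Lemma inv_lfun_involution (K : fieldType) (H : vectType K) (f : 'End(H)) :
  (f \o f)%VF = \1%VF -> (f^-1)%VF = f.
Proof.
move=> ff.
have -> : (f^-1 = f \o ((f \o f^-1) \o f) \o f)%VF.
  by rewrite !comp_lfunA ff comp_lfun1l -!comp_lfunA ff comp_lfun1r.
by rewrite inv_lfun_def ff comp_lfun1l.
Qed.

Lemma block_op_sum (C : numClosedFieldType) (E I : finType)
    (M : I -> E -> 'M[C]_2) :
  \sum_i block_op (M i) = block_op (fun e => \sum_i M i e).
Proof.
apply/lfunP=> u; apply/ffunP=> e.
rewrite sum_lfunE sum_ffunE block_opE mulmx_suml.
by apply: eq_bigr => i _; rewrite block_opE.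
Qed.

Lemma block_opB (C : numClosedFieldType) (E : finType) (M N : E -> 'M[C]_2) :
  block_op M - block_op N = block_op (fun e => M e - N e).
Proof.
apply/lfunP=> u; apply/ffunP=> e.
by rewrite add_lfunE opp_lfunE !ffunE !block_opE mulmxBl.
Qed.

Lemma mx2_diag_comm (C : numClosedFieldType) (a1 a2 b1 b2 p q : C) :
  mx2 a1 0 0 a2 *m (mx2 0 p q 0 *m mx2 b1 0 0 b2 - mx2 b1 0 0 b2 *m mx2 0 p q 0)
  = mx2 0 (a1 * (b2 - b1) * p) (a2 * (b1 - b2) * q) 0.
Proof.
rewrite !mx2M; apply/matrixP=> i j; rewrite !mxE !big_ord_recl big_ord0 !mxE /=.
by case: (i == 0); case: (j == 0); ring.
Qed.

Section OneForms.
Variables (R : realType) (T : real_even_triple R).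
Implicit Types D omega : 'End(hilb T).

Lemma rep_scalM k a : rep T (scal (alg T) k * a) = k *: rep T a.
Proof. by rewrite repM rep_scal -comp_lfunZl comp_lfun1l. Qed.

Lemma Omega1_fin (I : finType) (a b : I -> alg T) D :
  Omega1 D (\sum_i (rep T (a i) \o ((D \o rep T (b i)) - (rep T (b i) \o D)))%VF).
Proof.
exists #|I|, (fun i => a (enum_val i)), (fun i => b (enum_val i)).
by rewrite (reindex _ (onW_bij _ (enum_val_bij I))).
Qed.

(** The scalars lie in the algebra, so a factor of [D] can be compensated by
    dividing the coefficients [a i] by it. *)
Lemma Omega1Z k D omega : k != 0 -> Omega1 D omega -> Omega1 (k *: D) omega.
Proof.
move=> k0 [n [a [b ->]]]; exists n, (fun i => scal (alg T) k^-1 * a i), b.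
apply: eq_bigr => i _.
rewrite rep_scalM -!(comp_lfunZl, comp_lfunZr) -scalerBr.
by rewrite comp_lfunZr scalerA mulVf ?scale1r.
Qed.

(** Conjugation by [omega] turns [D] into [- D], and the two coefficients of the
    Wick rotation have difference [- 'i]. *)
Lemma wick_diracE omega :
  (omega \o omega)%VF = \1%VF ->
  (omega \o dirac T)%VF = - (dirac T \o omega)%VF ->
  wick_dirac omega = - 'i *: dirac T.
Proof.
move=> omega2 omegaD; rewrite /wick_dirac inv_lfun_involution // omegaD.
rewrite comp_lfunNl -comp_lfunA omega2 comp_lfun1r scalerN -scalerBl.
congr (_ *: _); rewrite -mulrBl opprD addrACA subrr add0r -mulr2n.
by rewrite -[_ *+ 2 in LHS]mulr_natr mulfK // pnatr_eq0.
Qed.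

Lemma Omega1_wick omega :
  (omega \o omega)%VF = \1%VF ->
  (omega \o dirac T)%VF = - (dirac T \o omega)%VF ->
  Omega1 (dirac T) omega -> Omega1 (wick_dirac omega) omega.
Proof.
move=> omega2 omegaD; rewrite wick_diracE //.
by apply: Omega1Z; rewrite oppr_eq0 neq0Ci.
Qed.

End OneForms.

Section Graph.
Variables (R : realType) (G : wgraph R) (o : orientation G).
Variable theta : edge G -> R.
Local Notation C := R[i].
Local Notation V := (vertex G).
Local Notation T := (canonical_triple o theta).

Lemma src_neq_tgt (e : edge G) : src o e != tgt o e.
Proof.
have := edges_card (valP e); rewrite (orientP o).
by rewrite cards2; case: eqP.
Qed.

Lemma edge_ends_inj (e f : edge G) :
  [set src o e; tgt o e] = [set src o f; tgt o f] -> e = f.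
Proof. by move=> ef; apply: val_inj; rewrite !(orientP o). Qed.

Lemma sum_indicB (x y : V) (F : V -> C) :
  \sum_w F w * ((w == x)%:R - (w == y)%:R) = F x - F y.
Proof.
under eq_bigr do rewrite mulrBr !mulr_natr !mulrb.
by rewrite sumrB -!big_mkcond !big_pred1_eq.
Qed.

(** The form is the sum over [w] of [c(., w) [D, b_w]], with [b_w] the indicator
    function of [w]: on the edge [e] the commutator is supported on the values
    [w = e-] and [w = e+], and the contribution of the repeated vertex vanishes
    with the diagonal of [c]. *)
Lemma Omega1_kernel (c : V -> V -> C) :
  (forall v, c v v = 0) ->
  Omega1 (T := T) (dirac T)
    (block_op (fun e => ((weight e)^-1)%:C%C *:
       mx2 0 (c (src o e) (tgt o e) * expi (theta e))
         (c (tgt o e) (src o e) * expi (- theta e)) 0)).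
Proof.
move=> c0.
pose a w : ffun_alg R V := [ffun v => c v w] : {ffun V -> C}.
pose b w : ffun_alg R V := [ffun v => (w == v)%:R] : {ffun V -> C}.
have cB x y : \sum_w a w x * (b w y - b w x) = c x y.
  by under eq_bigr do rewrite !ffunE; rewrite sum_indicB c0 subr0.
set omega := block_op _; suff -> : omega = \sum_w (canon_rep o (a w) \o
      ((canon_dirac theta \o canon_rep o (b w))
       - (canon_rep o (b w) \o canon_dirac theta)))%VF.
  exact: (Omega1_fin (T := T)).
under eq_bigr do rewrite !block_opM block_opB block_opM.
rewrite block_op_sum; apply: eq_block_op => e.
under eq_bigr do rewrite -scalemxAl -scalemxAr -scalerBr -scalemxAr.
rewrite -scaler_sumr; congr (_ *: _).
under eq_bigr do rewrite mx2_diag_comm.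
apply/matrixP=> i j; rewrite summxE !mxE.
under eq_bigr do rewrite mxE.
by case: (i == 0); case: (j == 0); rewrite ?big1_eq // -mulr_suml cB.
Qed.

(** Written as a sum over edges, so that no edge has to be chosen from its two
    ends; antisymmetry gives the zero diagonal. *)
Definition weight_kernel (v w : V) : C :=
  \sum_(e : edge G) 'i * (weight e)%:C%C *
    (((v == src o e) && (w == tgt o e))%:R
     - ((v == tgt o e) && (w == src o e))%:R).

Lemma weight_kernel_anti v w : weight_kernel w v = - weight_kernel v w.
Proof.
rewrite /weight_kernel -sumrN; apply: eq_bigr => e _.
by rewrite -mulrN opprB ![(w == _) && _]andbC.
Qed.

Lemma weight_kernel_diag v : weight_kernel v v = 0.
Proof.
rewrite /weight_kernel big1 // => e _.
by rewrite [(v == tgt o e) && _]andbC subrr mulr0.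
Qed.

(** Only the summand of [e] survives: no other edge has the same two ends, and
    the ends of [e] are distinct. *)
Lemma weight_kernel_edge e :
  weight_kernel (src o e) (tgt o e) = 'i * (weight e)%:C%C.
Proof.
rewrite /weight_kernel (bigD1 e) //= big1 => [|f fe].
  by rewrite !eqxx (negPf (src_neq_tgt e)) subr0 mulr1 addr0.
case: andP => [[/eqP es /eqP et]|_].
  by case/eqP: fe; apply: edge_ends_inj; rewrite es et.
case: andP => [[/eqP es /eqP et]|_]; last by rewrite subrr mulr0.
by case/eqP: fe; apply: edge_ends_inj; rewrite es et setUC.
Qed.

Definition wick_form : 'End(ell2 C (edge G)) :=
  block_op (fun e => mx2 0 ('i * expi (theta e)) (- ('i * expi (- theta e))) 0).

Lemma wick_form_Omega1 : Omega1 (T := T) (dirac T) wick_form.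
Proof.
suff -> : wick_form = block_op (fun e => ((weight e)^-1)%:C%C *:
       mx2 0 (weight_kernel (src o e) (tgt o e) * expi (theta e))
         (weight_kernel (tgt o e) (src o e) * expi (- theta e)) 0).
  exact: Omega1_kernel weight_kernel_diag.
apply: eq_block_op => e.
rewrite (weight_kernel_anti (src o e)) weight_kernel_edge mx2Z !mulr0.
have w0 : (weight e)%:C%C != 0 :> C.
  by rewrite fmorph_eq0 gt_eqF // weight_gt0.
rewrite fmorphV /= mulNr mulrN.
by congr mx2; [|congr (- _)]; rewrite -!mulrA mulrCA mulKf.
Qed.

Lemma wick_form_sa :
  is_adjoint (@ell2_dot C (edge G)) wick_form wick_form.
Proof.
apply: block_adjoint => e; rewrite mx2_tr mx2_map conjC0 rmorphN !rmorphM /=.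
by rewrite !conjCi !expi_conj opprK !mulNr opprK.
Qed.

(** [J] conjugates the phases back to themselves and conjugates the factor ['i]
    to its opposite. *)
Lemma wick_form_real u :
  canon_real theta (wick_form (canon_real theta u)) = - wick_form u.
Proof.
rewrite -opp_lfunE block_opN /canon_real block_conj_op block_conjM.
congr (fun_of_lfun _ u); apply: eq_block_op => e.
have uV := expiNr (theta e).
rewrite !mx2_map !mx2M mx2N conjC0 rmorphN !rmorphM /= !conjCi !expi_conj opprK.
by congr mx2; ring: uV.
Qed.

Lemma wick_form2 : (wick_form \o wick_form)%VF = \1%VF.
Proof.
rewrite block_opM -block_op1; apply: eq_block_op => e.
have uV := expiNr (theta e); have i2 : 'i ^+ 2 = -1 := @sqrCi C.
by rewrite mx2M -mx2_scalar; congr mx2; ring: uV i2.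
Qed.

Lemma wick_form_dirac :
  (wick_form \o canon_dirac theta)%VF = - (canon_dirac theta \o wick_form)%VF.
Proof.
rewrite !block_opM block_opN; apply: eq_block_op => e.
by rewrite mx2Z !mx2M mx2N; congr mx2; ring.
Qed.

End Graph.

Theorem proposition5 (R : realType) (G : wgraph R) (o : orientation G)
    (theta : edge G -> R) :
  WAL_type (canonical_triple o theta).
Proof.
exists (wick_form theta); split; first exact: wick_form_Omega1.
split; first exact: wick_form_sa.
split; first exact: wick_form_real.
split; first exact: wick_form2.
apply: (@Omega1_wick _ (canonical_triple o theta)).
- exact: wick_form2.
- exact: wick_form_dirac.
- exact: wick_form_Omega1.
Qed.
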